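(* Let $n\ge1$ be an integer and let $I\subseteq\{0,\ldots,n\}$ be such that $|I\cap\{0,n\}|=1$. Then the inclusion $$\bigcup_{i\in I}\partial_i\Delta_\epsilon^n\hookrightarrow\Delta_\epsilon^n$$ belongs to $\overline{\epsilon\text{-}\mathrm{Horn}}$.
   Context: $\Delta$ is the category of finite chains $[n]=\{0<\dots<n\}$ and non-decreasing maps. $\Delta_\epsilon$ is the category obtained from $\Delta$ by freely adding one object $[\epsilon]$, one arrow $w\colon[1]\to[\epsilon]$, and the induced compositions. An $\epsilon$-simplicial set is a presheaf of sets on $\Delta_\epsilon$; equivalently, a simplicial set $X$ together with a set $X_\epsilon$ and a map $X_\epsilon\to X_1$ (edges in its image are ''marked''). For $n\ge1$, $\Delta_\epsilon^n$ is the $\epsilon$-simplicial set with underlying simplicial set the standard simplex $\Delta^n$ and $(\Delta_\epsilon^n)_\epsilon$ a one-element set mapped to the edge from $0$ to $n$. $\partial_i\Delta_\epsilon^n\subset\Delta_\epsilon^n$ is the codimension-one face opposite the vertex $i$, where the marked edge remains marked if it belongs to the face (i.e. if $i\ne0,n$). $\Lambda^n_{\epsilon,i}=\bigcup_{j\neq i}\partial_j\Delta_\epsilon^n$. $\epsilon\text{-}\mathrm{Horn}$ denotes the set of inclusions $\Lambda^n_{\epsilon,0}\subset\Delta_\epsilon^n$ and $\Lambda^n_{\epsilon,n}\subset\Delta_\epsilon^n$, $n\ge1$. For a set $\mathcal{I}$ of morphisms of $\epsilon$-simplicial sets, $\overline{\mathcal{I}}$ is the class of morphisms having the left lifting property with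 respect to all morphisms that have the right lifting property with respect to every element of $\mathcal{I}$; it is the least weakly saturated class (closed under compositions, transfinite compositions, pushouts and retracts) containing $\mathcal{I}$. *)

(* Defs.v *)
From mathcomp Require Import all_boot.
From mathcomp Require Import boolp.

Set Implicit Arguments.
Unset Strict Implicit.
Unset Printing Implicit Defensive.

(* Composition is written in the usual order: [comp g f] is g after f. *)
Record category := Category {
  obj :> Type;
  hom : obj -> obj -> Type;
  idm : forall a, hom a a;
  comp : forall a b c, hom b c -> hom a b -> hom a c;
  comp1m : forall a b (f : hom a b), comp (idm b) f = f;
  compm1 : forall a b (f : hom a b), comp f (idm a) = f;
  compA : forall a b c d (h : hom c d) (g : hom b c) (f : hom a b),
    comp h (comp g f) = comp (comp h g) f }.

Arguments hom {_} _ _.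
Arguments idm {_} _.
Arguments comp {_ _ _ _} _ _.

(* Presheaves of sets.  Types play the role of sets: equality proofs are
   unique by proof irrelevance (from [boolp]). *)
Record presheaf (C : category) := Presheaf {
  sec :> C -> Type;
  restr : forall a b : C, hom a b -> sec b -> sec a;
  restr1 : forall (a : C) (x : sec a), restr (idm a) x = x;
  restrM : forall (a b c : C) (g : hom b c) (f : hom a b) (x : sec c),
    restr (comp g f) x = restr f (restr g x) }.

Arguments restr {_} _ {_ _} _ _.

Record psh_hom (C : category) (X Y : presheaf C) := PshHom {
  psh_fun :> forall a, X a -> Y a;
  psh_nat : forall (a b : C) (f : hom a b) (x : X b),
    psh_fun (restr X f x) = restr Y f (psh_fun x) }.

Lemma psh_comp_nat (C : category) (X Y Z : presheaf C)
    (g : psh_hom Y Z) (f : psh_hom X Y) (a b : C) (m : hom a b) (x : X b) :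
  g a (f a (restr X m x)) = restr Z m (g b (f b x)).
Proof. by rewrite !psh_nat. Qed.

Definition psh_comp (C : category) (X Y Z : presheaf C)
    (g : psh_hom Y Z) (f : psh_hom X Y) : psh_hom X Z :=
  @PshHom C X Z (fun a x => g a (f a x)) (psh_comp_nat g f).

Record subpresheaf (C : category) (X : presheaf C) := Subpresheaf {
  in_sub :> forall a, X a -> Prop;
  in_sub_restr : forall (a b : C) (f : hom a b) (x : X b),
    in_sub x -> in_sub (restr X f x) }.

Section SubPresheaf.
Variables (C : category) (X : presheaf C) (S : subpresheaf X).

Definition sub_sec (a : C) : Type := {x : X a | S a x}.

Definition sub_restr (a b : C) (f : hom a b) (x : sub_sec b) : sub_sec a :=
  exist _ (restr X f (sval x)) (in_sub_restr f (svalP x)).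

Lemma sub_restr1 (a : C) (x : sub_sec a) : sub_restr (idm a) x = x.
Proof. by case: x => x Sx; apply: eq_exist; rewrite /= restr1. Qed.

Lemma sub_restrM (a b c : C) (g : hom b c) (f : hom a b) (x : sub_sec c) :
  sub_restr (comp g f) x = sub_restr f (sub_restr g x).
Proof. by case: x => x Sx; apply: eq_exist; rewrite /= restrM. Qed.

Definition sub_psh : presheaf C := Presheaf sub_restr1 sub_restrM.

Definition sub_incl : psh_hom sub_psh X :=
  @PshHom C sub_psh X (fun a x => sval x) (fun a b f x => erefl).

End SubPresheaf.

Lemma sub_bigcup_restr (C : category) (X : presheaf C) (J : finType)
    (I : {set J}) (S : J -> subpresheaf X) (a b : C) (f : hom a b) (x : X b) :
  (exists2 i, i \in I & S i b x) ->
  exists2 i, i \in I & S i a (restr X f x).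
Proof. by case=> i iI Sx; exists i => //; apply: in_sub_restr. Qed.

Definition sub_bigcup (C : category) (X : presheaf C) (J : finType)
    (I : {set J}) (S : J -> subpresheaf X) : subpresheaf X :=
  @Subpresheaf C X (fun a x => exists2 i, i \in I & S i a x)
    (@sub_bigcup_restr C X J I S).

Definition lifts (C : category) (A B X Y : presheaf C)
    (i : psh_hom A B) (p : psh_hom X Y) : Prop :=
  forall (u : psh_hom A X) (v : psh_hom B Y),
    psh_comp p u = psh_comp v i ->
    exists h : psh_hom B X, psh_comp h i = u /\ psh_comp p h = v.

Definition mor_class (C : category) : Type :=
  forall A B : presheaf C, psh_hom A B -> Prop.

Definition rlp (C : category) (K : mor_class C) : mor_class C :=
  fun X Y p => forall (A B : presheaf C) (i : psh_hom A B),
    K A B i -> lifts i p.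

Definition llp (C : category) (K : mor_class C) : mor_class C :=
  fun A B i => forall (X Y : presheaf C) (p : psh_hom X Y),
    K X Y p -> lifts i p.

Definition saturation (C : category) (K : mor_class C) : mor_class C :=
  llp (rlp K).

(* [dmap m n] is the set of maps [m] -> [n] of Delta, where the chain
   [n] = {0 < ... < n} is 'I_n.+1. *)
Definition monotone m n (f : {ffun 'I_m.+1 -> 'I_n.+1}) : bool :=
  [forall i : 'I_m.+1, forall j : 'I_m.+1, (i <= j) ==> (f i <= f j)].

Definition dmap (m n : nat) : Type :=
  {f : {ffun 'I_m.+1 -> 'I_n.+1} | monotone f}.

Definition dfun m n (f : dmap m n) : 'I_m.+1 -> 'I_n.+1 := val f.

Lemma dmap_ext m n (f g : dmap m n) : dfun f =1 dfun g -> f = g.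
Proof. by move=> fg; apply/val_inj/ffunP. Qed.

Lemma dmapP m n (f : dmap m n) (i j : 'I_m.+1) :
  i <= j -> dfun f i <= dfun f j.
Proof. by move: i j; apply/'forall_'forall_implyP; apply: valP f. Qed.

Lemma mk_dmap_subproof m n (f : 'I_m.+1 -> 'I_n.+1) :
  (forall i j : 'I_m.+1, i <= j -> f i <= f j) -> monotone (finfun f).
Proof.
by move=> f_mono; apply/'forall_'forall_implyP => i j; rewrite !ffunE; apply: f_mono.
Qed.

Definition mk_dmap m n (f : 'I_m.+1 -> 'I_n.+1)
    (f_mono : forall i j : 'I_m.+1, i <= j -> f i <= f j) : dmap m n :=
  exist _ (finfun f) (mk_dmap_subproof f_mono).

Lemma mk_dmapE m n (f : 'I_m.+1 -> 'I_n.+1)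
    (f_mono : forall i j : 'I_m.+1, i <= j -> f i <= f j) :
  dfun (mk_dmap f_mono) =1 f.
Proof. by move=> i; rewrite /dfun ffunE. Qed.

Definition did n : dmap n n :=
  @mk_dmap n n (fun i => i) (fun i j le_ij => le_ij).

Definition dcomp m n p (g : dmap n p) (f : dmap m n) : dmap m p :=
  @mk_dmap m p (fun i => dfun g (dfun f i))
    (fun i j le_ij => dmapP g (dmapP f le_ij)).

Lemma dcompE m n p (g : dmap n p) (f : dmap m n) i :
  dfun (dcomp g f) i = dfun g (dfun f i).
Proof. exact: mk_dmapE. Qed.

Lemma didE n i : dfun (did n) i = i.
Proof. exact: mk_dmapE. Qed.

Lemma dcomp1m m n (f : dmap m n) : dcomp (did n) f = f.
Proof. by apply: dmap_ext => i; rewrite dcompE didE. Qed.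

Lemma dcompm1 m n (f : dmap m n) : dcomp f (did m) = f.
Proof. by apply: dmap_ext => i; rewrite dcompE didE. Qed.

Lemma dcompA m n p q (h : dmap p q) (g : dmap n p) (f : dmap m n) :
  dcomp h (dcomp g f) = dcomp (dcomp h g) f.
Proof. by apply: dmap_ext => i; rewrite !dcompE. Qed.

(* The category Delta_epsilon.  Since the object [epsilon] and the arrow
   w : [1] -> [epsilon] are added freely, a map [m] -> [epsilon] is w after a
   unique f : [m] -> [1], and is encoded by this f; the only map
   [epsilon] -> [epsilon] is the identity, and there is no map
   [epsilon] -> [n]. *)
Inductive deps_obj : Type := Chain of nat | Eps.

Definition deps_hom (a b : deps_obj) : Type :=
  match a, b with
  | Chain m, Chain n => dmap m n
  | Chain m, Eps => dmap m 1
  | Eps, Chain _ => Empty_set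
  | Eps, Eps => unit
  end.

Definition deps_id (a : deps_obj) : deps_hom a a :=
  match a with Chain n => did n | Eps => tt end.

Definition deps_comp (a b c : deps_obj) :
    deps_hom b c -> deps_hom a b -> deps_hom a c :=
  match a, b, c return deps_hom b c -> deps_hom a b -> deps_hom a c with
  | Chain m, Chain n, Chain p => fun g f => dcomp g f
  | Chain m, Chain n, Eps => fun g f => dcomp g f
  | Chain m, Eps, Eps => fun _ f => f
  | Eps, Eps, Eps => fun _ _ => tt
  | _, Eps, Chain _ => fun g _ => match g with end
  | Eps, Chain _, _ => fun _ f => match f with end
  end.

Lemma deps_comp1m (a b : deps_obj) (f : deps_hom a b) :
  deps_comp (deps_id b) f = f.
Proof. by case: a b f => [m|] [n|] //= => [f|[]]; rewrite ?dcomp1m. Qed.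

Lemma deps_compm1 (a b : deps_obj) (f : deps_hom a b) :
  deps_comp f (deps_id a) = f.
Proof. by case: a b f => [m|] [n|] //= => [f|f|[]]; rewrite ?dcompm1. Qed.

Lemma deps_compA (a b c d : deps_obj)
    (h : deps_hom c d) (g : deps_hom b c) (f : deps_hom a b) :
  deps_comp h (deps_comp g f) = deps_comp (deps_comp h g) f.
Proof.
case: a b c d h g f => [m|] [n|] [p|] [q|] //= h g f;
  by [rewrite dcompA | case: h | case: g | case: f].
Qed.

Definition delta_eps : category := Category deps_comp1m deps_compm1 deps_compA.

Definition eps_sset : Type := presheaf delta_eps.

(* The edge from 0 to n of the standard n-simplex. *)
Definition long_edge_fun n (i : 'I_2) : 'I_n.+1 :=
  if i == ord0 then ord0 else ord_max.

Lemma long_edge_mono n (i j : 'I_2) :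
  i <= j -> long_edge_fun n i <= long_edge_fun n j.
Proof.
rewrite /long_edge_fun; case: (eqVneq i ord0) => [//|i0].
by case: (eqVneq j ord0) => [->|//]; rewrite leqn0 => /eqP i0'; case/eqP: i0; apply: val_inj.
Qed.

Definition long_edge n : dmap 1 n := mk_dmap (@long_edge_mono n).

(* The eps-simplicial set Delta_eps^n: its k-simplices are the maps
   [k] -> [n], and w sends its only eps-element to the edge from 0 to n. *)
Definition simplex_sec (n : nat) (a : deps_obj) : Type :=
  match a with Chain k => dmap k n | Eps => unit end.

Definition simplex_restr (n : nat) (a b : deps_obj) :
    deps_hom a b -> simplex_sec n b -> simplex_sec n a :=
  match a, b return deps_hom a b -> simplex_sec n b -> simplex_sec n a with
  | Chain k, Chain m => fun f x => dcomp x f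
  | Chain k, Eps => fun f _ => dcomp (long_edge n) f
  | Eps, Chain _ => fun f _ => match f with end
  | Eps, Eps => fun _ x => x
  end.

Lemma simplex_restr1 n (a : delta_eps) (x : simplex_sec n a) :
  simplex_restr (idm a) x = x.
Proof. by case: a x => [k|] x //=; rewrite dcompm1. Qed.

Lemma simplex_restrM n (a b c : delta_eps) (g : hom b c) (f : hom a b)
    (x : simplex_sec n c) :
  simplex_restr (comp g f) x = simplex_restr f (simplex_restr g x).
Proof.
case: a b c g f x => [k|] [m|] [p|] //= g f x;
  by [rewrite dcompA | case: g | case: f].
Qed.

Definition simplex (n : nat) : eps_sset :=
  @Presheaf delta_eps (simplex_sec n) (@simplex_restr n)
    (@simplex_restr1 n) (@simplex_restrM n).

(* A simplex belongs to the face opposite to i when it avoids the vertex i;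
   the eps-element belongs to it when the edge from 0 to n does. *)
Definition avoids k n (i : 'I_n.+1) (x : dmap k n) : Prop :=
  forall j, dfun x j <> i.

Definition in_face n (i : 'I_n.+1) (a : deps_obj) : simplex_sec n a -> Prop :=
  match a return simplex_sec n a -> Prop with
  | Chain k => fun x => avoids i x
  | Eps => fun _ => avoids i (long_edge n)
  end.

Lemma in_face_restr n (i : 'I_n.+1) (a b : delta_eps) (f : hom a b)
    (x : simplex n b) :
  in_face i x -> in_face i (restr (simplex n) f x).
Proof.
case: a b f x => [k|] [m|] //= f x xi.
  by move=> j; rewrite dcompE; apply: xi.
by move=> j; rewrite dcompE; apply: xi.
Qed.

Definition face n (i : 'I_n.+1) : subpresheaf (simplex n) :=
  @Subpresheaf delta_eps (simplex n) (@in_face n i) (@in_face_restr n i).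

Lemma face_eps n (i : 'I_n.+1) :
  face i Eps tt <-> i <> ord0 /\ i <> ord_max.
Proof.
split=> [ni | [i0 im] j]; last first.
  by rewrite mk_dmapE /long_edge_fun; case: ifP => _ /esym.
by split=> /esym; [have := ni ord0 | have := ni ord_max]; rewrite mk_dmapE.
Qed.

Definition faces n (I : {set 'I_n.+1}) : subpresheaf (simplex n) :=
  sub_bigcup I (@face n).

Definition horn n (i : 'I_n.+1) : subpresheaf (simplex n) := faces [set~ i].

Inductive eps_horn : mor_class delta_eps :=
| EpsHornFirst n : 1 <= n -> eps_horn (sub_incl (horn (@ord0 n)))
| EpsHornLast n : 1 <= n -> eps_horn (sub_incl (horn (@ord_max n))).

(* Main.v *)
(** If I omits only one vertex, the inclusion is itself an outer horn.  Otherwise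
    I omits some inner vertex j; the face opposite to j contains the marked edge,
    hence is a copy of the simplex of dimension n - 1, which meets the union over
    I in a union of faces of the same kind.  A lifting problem is thus solved by
    first extending over this face (induction on n), and then from the union over
    I and j to the whole simplex (induction on the number of omitted vertices). *)
Require Import Defs.
From mathcomp Require Import all_boot.
From mathcomp Require Import boolp.

Set Implicit Arguments.
Unset Strict Implicit.
Unset Printing Implicit Defensive.

Lemma psh_hom_ext (C : category) (X Y : presheaf C) (f g : psh_hom X Y) :
  (forall a x, f a x = g a x) -> f = g.
Proof.
case: f g => f f_nat [g g_nat] /= fg.
have fgE : f = g by apply: functional_extensionality_dep => a; apply: funext.
by subst g; congr PshHom; apply: Prop_irrelevance.
Qed.

Section Glue.
Variables (C : category) (A B X : presheaf C) (m : psh_hom A B).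
Variables (S T : subpresheaf B).
Hypothesis TE : forall a x, T a x <-> S a x \/ exists y, m a y = x.
Variables (u : psh_hom (sub_psh S) X) (h : psh_hom A X).
Hypothesis m_inj : forall a, injective (m a).
Hypothesis uh : forall a y (Sy : S a (m a y)), h a y = u a (exist _ _ Sy).

Lemma glue_image a (x : sub_psh T a) :
  ~ S a (sval x) -> exists y, m a y = sval x.
Proof. by move=> nSx; case: ((TE _).1 (svalP x)). Qed.

(** Membership in [S] is decided classically and [u] takes priority; outside [S] a preimage under
    [m] is chosen, unique by [m_inj]. Agreement on the overlap is [uh]. *)
Definition glue_fun a (x : sub_psh T a) : X a :=
  match pselect (S a (sval x)) with
  | left Sx => u a (exist _ _ Sx)
  | right nSx => h a (sval (cid (glue_image nSx)))
  end.

Lemma glue_funS a (x : sub_psh T a) (Sx : S a (sval x)) :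
  glue_fun x = u a (exist _ _ Sx).
Proof.
rewrite /glue_fun; case: pselect => // Sx'.
by congr (u a (exist _ _ _)); apply: Prop_irrelevance.
Qed.

Lemma glue_funA a (x : sub_psh T a) y : m a y = sval x -> glue_fun x = h a y.
Proof.
case: x => x Tx /= yx; subst x; rewrite /glue_fun.
case: pselect => [Sx | nSx] /=; first by rewrite -uh.
by case: cid => z /= /m_inj ->.
Qed.

Lemma glue_nat a b (f : hom a b) (x : sub_psh T b) :
  glue_fun (restr (sub_psh T) f x) = restr X f (glue_fun x).
Proof.
case: (pselect (S b (sval x))) => [Sx | /glue_image[y yx]].
  rewrite (glue_funS Sx) -psh_nat (@glue_funS a (restr (sub_psh T) f x) (in_sub_restr f Sx)).
  by congr (u a _); apply: eq_exist.
by rewrite (glue_funA yx) -psh_nat; apply: glue_funA; rewrite psh_nat yx.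
Qed.

Definition glue : psh_hom (sub_psh T) X := PshHom glue_nat.

End Glue.

(** The hypotheses make [T] the pushout of [S] and [A] along [R]: a lift over [A] glues with [u] to
    a map on [T], which then extends to [B]. *)
Lemma lifts_union (C : category) (A B X Y : presheaf C) (m : psh_hom A B)
    (R : subpresheaf A) (S T : subpresheaf B) (p : psh_hom X Y) :
  (forall a, injective (m a)) ->
  (forall a y, R a y <-> S a (m a y)) ->
  (forall a x, T a x <-> S a x \/ exists y, m a y = x) ->
  lifts (sub_incl R) p -> lifts (sub_incl T) p -> lifts (sub_incl S) p.
Proof.
move=> m_inj RE TE Rp Tp u v puv.
have puvE a x : p a (u a x) = v a (sval x) := congr1 (fun k => psh_fun k x) puv.
pose mR_fun a (y : sub_psh R a) : sub_psh S a :=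
  exist _ (m a (sval y)) ((RE a _).1 (svalP y)).
have mR_nat a b (f : hom a b) (y : sub_psh R b) :
    mR_fun a (restr (sub_psh R) f y) = restr (sub_psh S) f (mR_fun b y).
  by apply: eq_exist; rewrite /= psh_nat.
have [|h [hu hv]] := Rp (psh_comp u (PshHom mR_nat)) (psh_comp v m).
  by apply: psh_hom_ext => a y /=; rewrite puvE.
(* The lift [h] extends [u] only along [R]; as [R] is the full preimage of [S], this gives agreement
   on the whole overlap. *)
have uh a y (Sy : S a (m a y)) : h a y = u a (exist _ _ Sy).
  have Ry := (RE a y).2 Sy.
  have := congr1 (fun k => psh_fun k (exist _ y Ry : sub_psh R a)) hu.
  move=> /= ->; congr (u a _); exact: eq_exist.
have [|k [kg kv]] := Tp (glue TE m_inj uh) v.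
  apply: psh_hom_ext => a x /=.
  case: (pselect (S a (sval x))) => [Sx | /(glue_image TE)[y yx]].
    by rewrite (glue_funS _ _ _ Sx) puvE.
  rewrite (glue_funA TE m_inj uh yx) -yx.
  exact: (congr1 (fun k => psh_fun k y) hv).
exists k; split=> //; apply: psh_hom_ext => a [x Sx] /=.
have Tx : T a x by apply/TE; left.
have := congr1 (fun k => psh_fun k (exist _ _ Tx : sub_psh T a)) kg.
by rewrite /= => ->; apply: glue_funS.
Qed.

Section EndpointMap.
Variables (m n : nat) (d : dmap m n).
Hypotheses (d0 : dfun d ord0 = ord0) (dmax : dfun d ord_max = ord_max).

(** Preserving both endpoints is what lets [d] act on marked elements as well as on simplices. *)
Lemma dcomp_long_edge : dcomp d (long_edge m) = long_edge n.
Proof.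
by apply: dmap_ext => i; rewrite dcompE !mk_dmapE /long_edge_fun; case: ifP.
Qed.

Definition simplex_map_fun (a : delta_eps) : simplex m a -> simplex n a :=
  match a with Chain k => fun x => dcomp d x | Eps => fun x => x end.

Lemma simplex_map_nat (a b : delta_eps) (f : hom a b) (x : simplex m b) :
  simplex_map_fun (restr (simplex m) f x) =
  restr (simplex n) f (simplex_map_fun x).
Proof.
case: a b f x => [k|] [l|] //= f x; first by rewrite dcompA.
by rewrite dcompA dcomp_long_edge.
Qed.

Definition simplex_map : psh_hom (simplex m) (simplex n) :=
  PshHom simplex_map_nat.

Lemma simplex_map_inj :
  injective (dfun d) -> forall a, injective (simplex_map a).
Proof.
move=> d_inj [k|] //= x y xy; apply: dmap_ext => i.
by apply: d_inj; rewrite -!dcompE xy.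
Qed.

End EndpointMap.

Section Coface.
Variables (n : nat) (j : 'I_n.+2).

Lemma lift_mono (i k : 'I_n.+1) : i <= k -> lift j i <= lift j k.
Proof. by rewrite leq_bump2. Qed.

Definition coface : dmap n n.+1 := mk_dmap lift_mono.

Lemma cofaceE i : dfun coface i = lift j i.
Proof. exact: mk_dmapE. Qed.

Lemma coface_inj : injective (dfun coface).
Proof. by move=> i k; rewrite !cofaceE; apply: lift_inj. Qed.

Lemma coface0 : j != ord0 -> dfun coface ord0 = ord0.
Proof.
move=> j0; rewrite cofaceE; apply: val_inj; rewrite /= /bump leqn0.
by case: (eqVneq (j : nat) 0) => // /eqP; rewrite -[_ == _]/(j == ord0) (negPf j0).
Qed.

Lemma coface_max : j != ord_max -> dfun coface ord_max = ord_max.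
Proof.
move=> jmax; rewrite cofaceE; apply: val_inj; rewrite /= /bump.
suff -> : j <= n by [].
by rewrite -ltnS ltn_neqAle -ltnS ltn_ord andbT.
Qed.

(** [lift j] is an increasing bijection onto the vertices other than [j], so the values of [x] can
    be unlifted one by one. *)
Lemma avoids_cofaceP k (x : dmap k n.+1) :
  avoids j x <-> exists y, dcomp coface y = x.
Proof.
split=> [xj | [y <-] i]; last first.
  by rewrite dcompE cofaceE => /eqP; rewrite eq_sym (negPf (neq_lift _ _)).
(* A sigma type rather than an existential, so that the factorization is defined by projection. *)
have xE i : {l | dfun x i = lift j l}.
  by case: (unliftP j (dfun x i)) => [l ->|/xj//]; exists l.
have y_mono (i l : 'I_k.+1) : i <= l -> sval (xE i) <= sval (xE l).
  move/(dmapP x); case: (xE i) (xE l) => a xa [b xb] /=.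
  by rewrite xa xb leq_bump2.
exists (mk_dmap y_mono); apply: dmap_ext => i.
by rewrite dcompE cofaceE mk_dmapE; case: (xE i).
Qed.

Lemma avoids_lift_coface k (x : dmap k n) (i : 'I_n.+1) :
  avoids (lift j i) (dcomp coface x) <-> avoids i x.
Proof.
split=> xi l; first by move=> xl; apply: (xi l); rewrite dcompE cofaceE xl.
by rewrite dcompE cofaceE => /lift_inj; apply: xi.
Qed.

(** This computes the trace on the face opposite [j] of the union over [I]. Since [j] is not in [I],
    every index in [I] has the form [lift j l], so no face is lost. *)
Lemma exists_avoids_coface k (x : dmap k n) (I : {set 'I_n.+2}) :
  j \notin I ->
  (exists2 i, i \in [set i | lift j i \in I] & avoids i x) <->
  (exists2 i, i \in I & avoids i (dcomp coface x)).
Proof.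
move=> jI; split=> [[i] | [i iI]].
  by rewrite inE => iI xi; exists (lift j i) => //; apply/avoids_lift_coface.
case: (unliftP j i) iI => [l -> lI | -> /(negP jI) //].
by move/avoids_lift_coface => xl; exists l; rewrite ?inE.
Qed.

End Coface.

Lemma lifts_add_face n (I : {set 'I_n.+2}) (j : 'I_n.+2) X Y
    (p : psh_hom X Y) :
  j != ord0 -> j != ord_max -> j \notin I ->
  lifts (sub_incl (faces [set i | lift j i \in I])) p ->
  lifts (sub_incl (faces (j |: I))) p ->
  lifts (sub_incl (faces I)) p.
Proof.
move=> j0 jmax jI.
have [d0 dmax] := (coface0 j0, coface_max jmax).
apply: (@lifts_union _ _ _ _ _ (simplex_map d0 dmax)).
- by apply: simplex_map_inj; apply: coface_inj.
- case=> [k|] x /=; first exact: exists_avoids_coface.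
  (* The marked element lies in a face when its long edge does, and this edge is the image under the
     coface of the long edge one dimension lower. *)
  by rewrite -(dcomp_long_edge d0 dmax); apply: exists_avoids_coface.
move=> a x; split=> [[i /setU1P[-> | iI] xi] | [[i iI xi] | [y <-]]].
- right; case: a x xi => [k|] x /=; first by move/avoids_cofaceP.
  by exists x.
- by left; exists i.
- by exists i => //; rewrite inE iI orbT.
exists j; first exact: setU11.
case: a y {x} => [k|] y /=; first by apply/avoids_cofaceP; exists y.
by apply/avoids_cofaceP; exists (long_edge n); apply: dcomp_long_edge.
Qed.

(** The exclusive-or survives both inductions: the coface at an inner vertex fixes the endpoints,
    and adding an inner vertex to [I] leaves the endpoints in [I] unchanged. *)
Lemma saturation_outer_faces n (I : {set 'I_n.+1}) :
  (ord0 \in I) (+) (ord_max \in I) -> saturation eps_horn (sub_incl (faces I)).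
Proof.
move=> I_outer X Y p p_rlp.
elim: n I I_outer => [|n IHn] I.
  (* In dimension 0 the endpoints coincide, so the hypothesis is false. *)
  by rewrite (_ : ord_max = ord0) ?addbb //; apply: val_inj.
have [c] := ubnP #|~: I|; elim: c I => // c IHc I Ic I_outer.
have horn_or (e : 'I_n.+2) : e \notin I ->
    I = [set~ e] \/ exists2 j, j \notin I & j != e.
  move=> eI; case: (pickP [pred j | (j \notin I) && (j != e)]) => [j /andP[]|jN].
    by right; exists j.
  left; apply/setP => j; rewrite !inE; have /= := jN j.
  by case: (eqVneq j e) => [-> | _]; rewrite ?(negPf eI) // andbT => /negbFE.
have add_face j : j \notin I -> j != ord0 -> j != ord_max ->
    lifts (sub_incl (faces I)) p.
  move=> jI j0 jmax; apply: (lifts_add_face j0 jmax jI).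
    by apply: IHn; rewrite !inE -!cofaceE coface0 ?coface_max.
  apply: IHc; last by rewrite !inE !(eq_sym _ j) (negPf j0) (negPf jmax).
  rewrite -ltnS (leq_trans _ Ic) // ltnS proper_card // setCU properE subsetIr /=.
  by apply/subsetPn; exists j; rewrite !inE ?eqxx.
(* [horn_or] is applied to the omitted endpoint. Any other omitted vertex is inner, because the
   opposite endpoint lies in [I]. *)
case: (boolP (ord0 \in I)) I_outer => [I0 | nI0] /= Imax.
  have [-> | [j jI jmax]] := horn_or _ Imax; first exact/p_rlp/EpsHornLast.
  by apply: (add_face j) => //; apply: contraNneq jI => ->.
have [-> | [j jI j0]] := horn_or _ nI0; first exact/p_rlp/EpsHornFirst.
by apply: (add_face j) => //; apply: contraNneq jI => ->.
Qed.

Theorem theorem6p4 (n : nat) (hn : 1 <= n) (I : {set 'I_n.+1})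
    (hI : #|I :&: [set ord0; ord_max]| = 1) :
  saturation eps_horn (sub_incl (faces I)).
Proof.
apply: saturation_outer_faces.
(* For [n] at least 1 the endpoints are distinct, so the cardinal is the sum of two membership bits,
   equal to 1 exactly when they differ. *)
have n0 : (ord0 : 'I_n.+1) != ord_max by rewrite -val_eqE /= eq_sym -lt0n.
move: hI; rewrite setIUr cardsU -setIA.
have -> : [set ord0] :&: (I :&: [set ord_max]) = set0 :> {set 'I_n.+1}.
  apply/setP => i; rewrite !inE; case: (eqVneq i ord0) => [->|//].
  by rewrite (negPf n0) andbF.
rewrite setI0 cards0 subn0.
have cardI1 e : #|I :&: [set e]| = (e \in I).
  case: (boolP (e \in I)) => eI; first by rewrite (setIidPr _) ?sub1set ?cards1.
  by apply/eqP; rewrite cards_eq0 setI_eq0 disjoint_sym disjoints1.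
by rewrite !cardI1; case: (_ \in I); case: (_ \in I).
Qed.
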